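(* Let $\Gamma$ be a quiver with $\Gamma=\Gamma'\cup\Gamma''$, where $\Gamma'$ and $\Gamma''$ are sub-quivers of $\Gamma$ and $\Gamma'\cap\Gamma''=\emptyset$, and let $(T,f)$ be a top-representation of $\Gamma$. Let $(T_1,f_1)$ be the top-representation of $\Gamma'$ obtained by restricting $(T,f)$ to $\Gamma'$ (that is, $T_1(i)=T(i)$ and $(f_1)_\alpha=f_\alpha$ for vertices $i$ and arrows $\alpha$ of $\Gamma'$), and similarly let $(T_2,f_2)$ be the restriction of $(T,f)$ to $\Gamma''$. Then $$H_n(T,f)\simeq H_n(T_1,f_1)\times H_n(T_2,f_2)\quad\text{for all } n\geq0.$$
   Context: A quiver $\Gamma=(\Gamma_0,\Gamma_1)$ is an oriented graph with vertex set $\Gamma_0$ and arrow set $\Gamma_1$; a sub-quiver is an oriented sub-graph. A top-representation $(T,f)$ of $\Gamma$ is a family of topological spaces $T(i)$, $i\in\Gamma_0$, with a continuous map $f_\alpha:T(i)\to T(j)$ for each arrow $\alpha:i\to j$. For a topological space $X$, $S(X)$ is its singular chain complex (with $S_{-1}(X)=0$, $S(\emptyset)=0$), and $g_*=S(g)$ for a continuous map $g$. For a top-representation $(T,f)$ of $\Gamma$, $\lim^{\Gamma,\bullet}(T,f)$ is the subcomplex of $\prod_{i\in\Gamma_0}S(T(i))$ whose degree $n$ part is $$\{(x_i)_{i\in\Gamma_0}: x_i\in S_n(T(i)),\ (f_\alpha)_*(x_i)=x_j\text{ for every arrow }\alpha:i\to j\},$$ and $H_n(T,f):=H_n(\lim^{\Gamma,\bullet}(T,f))$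 for $n\ge0$; analogously for the quivers $\Gamma'$, $\Gamma''$. *)

(* Defs.v *)
From HB Require Import structures.
From mathcomp Require Import freeg.
From mathcomp Require Import all_boot all_order all_algebra.
From mathcomp Require Import zify.
From mathcomp Require Import boolp classical_sets functions reals topology normedtype.

Set Implicit Arguments.
Unset Strict Implicit.
Unset Printing Implicit Defensive.

Import Order.TTheory GRing.Theory Num.Theory. Import numFieldNormedType.Exports.
Local Open Scope classical_set_scope.
Local Open Scope ring_scope.

(* MathComp has no abelian group structure on dependent products over an
   arbitrary (possibly infinite) index type. *)
Section DependentProduct.
Variables (I : Type) (V : I -> zmodType).

Definition dprod : Type := forall i, V i.

HB.instance Definition _ := Choice.copy dprod (forall i, V i).

Definition dprod_zero : dprod := fun=> 0.
Definition dprod_opp (x : dprod) : dprod := fun i => - x i.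
Definition dprod_add (x y : dprod) : dprod := fun i => x i + y i.

Fact dprod_addA : associative dprod_add.
Proof. by move=> x y z; apply: functional_extensionality_dep => i; apply: addrA. Qed.
Fact dprod_addC : commutative dprod_add.
Proof. by move=> x y; apply: functional_extensionality_dep => i; apply: addrC. Qed.
Fact dprod_add0 : left_id dprod_zero dprod_add.
Proof. by move=> x; apply: functional_extensionality_dep => i; apply: add0r. Qed.
Fact dprod_addN : left_inverse dprod_zero dprod_opp dprod_add.
Proof. by move=> x; apply: functional_extensionality_dep => i; apply: addNr. Qed.

HB.instance Definition _ :=
  GRing.isZmodule.Build dprod dprod_addA dprod_addC dprod_add0 dprod_addN.

End DependentProduct.

Section Subgroup.
Variables (V : zmodType) (P : zmodClosed V).

Record subgroup : Type := Subgroup { subgroup_val :> V; _ : subgroup_val \in P }.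

HB.instance Definition _ := [isSub for subgroup_val].
HB.instance Definition _ := [Choice of subgroup by <:].
HB.instance Definition _ := [SubChoice_isSubZmodule of subgroup by <:].

End Subgroup.

(* Nonnegatively graded: the term of degree -1 is implicitly zero, so that
   every element of degree 0 is a is_cycle. *)
Record chain_complex := ChainComplex {
  chain :> nat -> zmodType;
  bd : forall n, {additive chain n.+1 -> chain n};
  bd_bd : forall n (x : chain n.+2), bd n (bd n.+1 x) = 0
}.

Arguments bd : clear implicits.

Section Homology.
Variables (C : chain_complex) (n : nat).

Definition is_cycle : {pred C n} :=
  match n return {pred C n} with
  | 0 => predT
  | m.+1 => [pred x | bd C m x == 0]
  end.

Fact is_cycle_closed : zmod_closed is_cycle.
Proof.
rewrite /is_cycle; case: n => [|m]; first by split.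
split=> [|x y]; rewrite !inE ?raddf0 // => /eqP hx /eqP hy.
by rewrite raddfB hx hy subrr.
Qed.
HB.instance Definition _ := GRing.isZmodClosed.Build (C n) is_cycle is_cycle_closed.

Definition cycles : zmodType := subgroup is_cycle.

Definition is_boundary : {pred cycles} :=
  [pred z | `[< exists y, bd C n y = subgroup_val z >]].

Lemma is_boundaryP (z : cycles) :
  reflect (exists y, bd C n y = subgroup_val z) (z \in is_boundary).
Proof. exact: asboolP. Qed.

Fact is_boundary_closed : zmod_closed is_boundary.
Proof.
split=> [|x y]; first by apply/is_boundaryP; exists 0; rewrite raddf0.
move=> /is_boundaryP[u hu] /is_boundaryP[v hv]; apply/is_boundaryP; exists (u - v).
by rewrite raddfB hu hv.
Qed.
HB.instance Definition _ := GRing.isZmodClosed.Build cycles is_boundary is_boundary_closed.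

Definition homology : zmodType := Quotient.quot is_boundary.

End Homology.

Section ProductComplex.
Variables (I : Type) (C : I -> chain_complex).

Definition prod_bd n (x : dprod (fun i => C i n.+1)) : dprod (fun i => C i n) :=
  fun i => bd (C i) n (x i).

Fact prod_bd_additive n : zmod_morphism (@prod_bd n).
Proof. by move=> x y; apply: functional_extensionality_dep => i; apply: raddfB. Qed.
HB.instance Definition _ n :=
  GRing.isZmodMorphism.Build _ _ (@prod_bd n) (@prod_bd_additive n).

Fact prod_bd_bd n (x : dprod (fun i => C i n.+2)) : prod_bd (prod_bd x) = 0.
Proof. by apply: functional_extensionality_dep => i; apply: bd_bd. Qed.

Definition prod_complex : chain_complex :=
  @ChainComplex (fun n => dprod (fun i => C i n)) (fun n => @prod_bd n) prod_bd_bd.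

End ProductComplex.

Section Subcomplex.
Variables (C : chain_complex) (P : forall n, zmodClosed (C n)).
Hypothesis P_bd : forall n (x : C n.+1), x \in P n.+1 -> bd C n x \in P n.

Definition sub_bd n (x : subgroup (P n.+1)) : subgroup (P n) :=
  Subgroup (P_bd (valP x)).

Fact sub_bd_additive n : zmod_morphism (@sub_bd n).
Proof. by move=> x y; apply: val_inj; apply: (raddfB (bd C n)). Qed.
HB.instance Definition _ n :=
  GRing.isZmodMorphism.Build _ _ (@sub_bd n) (@sub_bd_additive n).

Fact sub_bd_bd n (x : subgroup (P n.+2)) : sub_bd (sub_bd x) = 0.
Proof. by apply: val_inj; apply: bd_bd. Qed.

Definition subcomplex : chain_complex :=
  @ChainComplex (fun n => subgroup (P n)) (fun n => @sub_bd n) sub_bd_bd.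

End Subcomplex.

Section StandardSimplex.
Variable R : realType.

Definition std_simplex n : set 'rV[R]_n.+1 :=
  [set x | (forall i, 0 <= x ord0 i) /\ \sum_i x ord0 i = 1].
Arguments std_simplex : clear implicits.

(* The affine map sending the vertex k of the n-simplex to the vertex
   [lift i k] of the (n+1)-simplex. *)
Definition coface_row n (i : 'I_n.+2) (x : 'rV[R]_n.+1) : 'rV[R]_n.+2 :=
  \row_j (if unlift i j is Some k then x ord0 k else 0).

Fact coface_subproof n (i : 'I_n.+2) (x : std_simplex n) :
  coface_row i (val x) \in std_simplex n.+1.
Proof.
have [x0 x1] := set_valP x; apply/mem_set; split=> [j|].
  by rewrite mxE; case: unliftP.
rewrite (bigD1_ord i) //= mxE unlift_none add0r -[RHS]x1.
by apply: eq_bigr => j _; rewrite mxE liftK.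
Qed.

Definition coface n (i : 'I_n.+2) (x : std_simplex n) : std_simplex n.+1 :=
  exist _ (coface_row i (val x)) (coface_subproof i x).

Fact coface_row_continuous n (i : 'I_n.+2) : continuous (@coface_row n i).
Proof.
move=> x A [P Px PA]; exists (fun a k => P ord0 (lift i k)) => [a k|y Py].
  by have := Px ord0 (lift i k); rewrite mxE liftK (ord1 a).
apply: PA => a j; rewrite (ord1 a) mxE.
case: unliftP => [k ->|ji]; first exact: Py.
by have := Px ord0 j; rewrite mxE -ji unlift_none => /nbhs_singleton.
Qed.

Fact coface_continuous n (i : 'I_n.+2) : continuous (@coface n i).
Proof.
apply: continuous_comp_initial => x.
apply: (@continuous_comp _ _ _ (fun y : std_simplex n => val y) (@coface_row n i)).
  exact: initial_continuous.
exact: coface_row_continuous.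
Qed.
HB.instance Definition _ n (i : 'I_n.+2) :=
  isContinuous.Build _ _ (@coface n i) (@coface_continuous n i).

End StandardSimplex.

Arguments std_simplex : clear implicits.

Lemma eq_freeg_additive (K : choiceType) (M : zmodType)
    (h1 h2 : {additive {freeg K / int} -> M}) :
  (forall x, h1 << x >> = h2 << x >>) -> h1 =1 h2.
Proof.
move=> h12 D; rewrite -(freeg_sumE D) !raddf_sum; apply: eq_bigr => x _.
by rewrite -[coeff x D]intz -freegU_mulz !raddfMz h12.
Qed.

HB.instance Definition _ (K : choiceType) (M : lmodType int) (f : K -> M) :=
  GRing.isZmodMorphism.Build {freeg K / int} M (fglift f) (lift_is_additive f).

Lemma fglift1 (K : choiceType) (M : lmodType int) (f : K -> M) x :
  fglift f (<< x >> : {freeg K / int}) = f x.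
Proof. by rewrite liftU scale1r. Qed.

Section SingularComplex.
Variable R : realType.

Definition sing_simplex (X : topologicalType) n :=
  continuousType (std_simplex R n) X.

HB.instance Definition _ X n := Choice.on (sing_simplex X n).

Definition face (X : topologicalType) n (i : 'I_n.+2) (s : sing_simplex X n.+1) :
  sing_simplex X n := s \o @coface R n i.

Definition sing_chain (X : topologicalType) n : zmodType :=
  {freeg (sing_simplex X n) / int}.

Definition sing_bd (X : topologicalType) n : sing_chain X n.+1 -> sing_chain X n :=
  fglift (fun s : sing_simplex X n.+1 =>
    \sum_(i < n.+2) (-1) ^+ i *: (<< face i s >> : {freeg (sing_simplex X n) / int})).
HB.instance Definition _ X n := GRing.Additive.on (@sing_bd X n).

(* Exchanges the two ways of omitting the vertices [a] and [lift a b]. *)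
Definition face_swap n (p : 'I_n.+3 * 'I_n.+2) : 'I_n.+3 * 'I_n.+2 :=
  (lift p.1 p.2, inord (unbump p.2 p.1)).

Fact face_swap2E n (p : 'I_n.+3 * 'I_n.+2) :
  (face_swap p).2 = unbump p.2 p.1 :> nat.
Proof.
rewrite /= inordK //; case: p => -[a ha] [b hb]; rewrite /unbump /=.
lia.
Qed.

Fact face_swapK n : involutive (@face_swap n).
Proof.
move=> p; have hs := face_swap2E p; case: p hs => a b /= hs.
apply/eqP; rewrite /face_swap xpair_eqE; apply/andP; split; apply/eqP/val_inj.
  by rewrite /= hs /bump /unbump; case: (ltngtP b a) => /= ?; lia.
have := face_swap2E (face_swap (a, b)); rewrite /face_swap /= => ->.
by rewrite hs /bump /unbump; lia.
Qed.

Fact face_swap_ltn n (p : 'I_n.+3 * 'I_n.+2) :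
  ((face_swap p).2 < (face_swap p).1)%N = ~~ (p.2 < p.1)%N.
Proof. by rewrite face_swap2E /= /bump /unbump; lia. Qed.

Fact face_swap_sign n (p : 'I_n.+3 * 'I_n.+2) :
  (-1) ^+ ((face_swap p).1 + (face_swap p).2) = - (-1) ^+ (p.1 + p.2) :> int.
Proof.
rewrite face_swap2E /= -signr_odd -[in RHS]signr_odd -signrN; congr (_ ^+ _).
by rewrite /bump /unbump; case: (leqP p.1 p.2) => h; lia.
Qed.

Fact coface_face_swap n (p : 'I_n.+3 * 'I_n.+2) (x : 'rV[R]_n.+1) :
  coface_row (face_swap p).1 (coface_row (face_swap p).2 x) =
  coface_row p.1 (coface_row p.2 x).
Proof.
case: p => a b; set a' := (face_swap _).1; set b' := (face_swap _).2.
have liftE c d (y : 'rV[R]_c.+1) i : coface_row d y ord0 (lift d i) = y ord0 i.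
  by rewrite mxE liftK.
have skipE c d (y : 'rV[R]_c.+1) : coface_row d y ord0 d = 0.
  by rewrite mxE unlift_none.
have hb' : b' = unbump b a :> nat := face_swap2E (a, b).
have ha : a = lift a' b'.
  by apply: val_inj; rewrite /= hb' /bump /unbump; case: (ltngtP b a) => /= ?; lia.
apply/rowP => j; case: (unliftP a j) => [k ->|->]; last first.
  by rewrite [RHS]skipE [in LHS]ha liftE skipE.
rewrite [RHS]liftE; case: (unliftP b k) => [l ->|->]; last first.
  by rewrite [RHS]skipE -[lift a b]/a' skipE.
have -> : lift a (lift b l) = lift a' (lift b' l).
  by apply: val_inj; rewrite /= hb' bumpC.
by rewrite !liftE.
Qed.

Fact face_face_swap X n (p : 'I_n.+3 * 'I_n.+2) (s : sing_simplex X n.+2) :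
  face (face_swap p).2 (face (face_swap p).1 s) = face p.2 (face p.1 s).
Proof.
apply/continuousEP => x; congr (s _); apply: val_inj.
exact: coface_face_swap.
Qed.

Fact sing_bd_bd X n (c : sing_chain X n.+2) : sing_bd (sing_bd c) = 0.
Proof.
apply: (@eq_freeg_additive _ _ (@sing_bd X n \o @sing_bd X n.+1) \0 _ c) => s /=.
pose F (p : 'I_n.+3 * 'I_n.+2) : sing_chain X n :=
  (-1) ^+ (p.1 + p.2) *: << face p.2 (face p.1 s) >>.
have -> : sing_bd (sing_bd << s >>) = \sum_p F p.
  rewrite {2}/sing_bd fglift1 raddf_sum -(pair_bigA _ (fun a b => F (a, b))) /=.
  apply: eq_bigr => a _; rewrite raddfZsign /= /sing_bd fglift1 scaler_sumr.
  by apply: eq_bigr => b _; rewrite scalerA -exprD.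
rewrite (bigID (fun p : 'I_n.+3 * 'I_n.+2 => (p.2 < p.1)%N)) /=.
rewrite (reindex_inj (inv_inj (@face_swapK n))) /=.
under eq_bigl do rewrite -/(face_swap _).1 -/(face_swap _).2 face_swap_ltn.
under eq_bigr do rewrite /F face_swap_sign face_face_swap scaleNr.
by rewrite sumrN addNr.
Qed.

Definition singular_complex (X : topologicalType) : chain_complex :=
  @ChainComplex (sing_chain X) (@sing_bd X) (@sing_bd_bd X).

Definition push (X Y : topologicalType) (g : continuousType X Y) n
  (s : sing_simplex X n) : sing_simplex Y n := g \o s.

Definition sing_map (X Y : topologicalType) (g : continuousType X Y) n :
    singular_complex X n -> singular_complex Y n :=
  fglift (fun s : sing_simplex X n =>
    << push g s >> : {freeg (sing_simplex Y n) / int}).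
HB.instance Definition _ (X Y : topologicalType) (g : continuousType X Y) n :=
  GRing.Additive.on (@sing_map X Y g n).

Fact sing_map_bd (X Y : topologicalType) (g : continuousType X Y) n
    (x : singular_complex X n.+1) :
  sing_map g (bd _ n x) = bd _ n (sing_map g x).
Proof.
apply: (@eq_freeg_additive _ _ (@sing_map X Y g n \o @sing_bd X n)
  (@sing_bd Y n \o @sing_map X Y g n.+1)) => s /=.
rewrite /sing_bd /sing_map !fglift1 raddf_sum; apply: eq_bigr => i _.
rewrite raddfZsign /= fglift1; congr (_ *: << _ >>).
exact/continuousEP.
Qed.

End SingularComplex.

Record quiver := Quiver {
  vertex : Type;
  arrow : Type;
  source : arrow -> vertex;
  target : arrow -> vertex
}.

Record top_rep (G : quiver) := TopRep {
  rep_space : vertex G -> topologicalType;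
  rep_map : forall a : arrow G,
    continuousType (rep_space (source a)) (rep_space (target a))
}.

Section LimitHomology.
Variables (R : realType) (G : quiver) (T : top_rep G).

Local Notation prodS := (prod_complex (fun i => singular_complex R (rep_space T i))).

Definition compatible n : {pred prodS n} :=
  [pred x | `[< forall a : arrow G,
    sing_map (rep_map T a) (x (source a)) = x (target a) >]].
Arguments compatible : clear implicits.

Lemma compatibleP n (x : prodS n) :
  reflect (forall a, sing_map (rep_map T a) (x (source a)) = x (target a))
    (x \in compatible n).
Proof. exact: asboolP. Qed.

Fact compatible_closed n : zmod_closed (compatible n).
Proof.
split=> [|x y /compatibleP hx /compatibleP hy]; apply/compatibleP => a.
  exact: raddf0.
apply: etrans (raddfB (@sing_map _ _ _ (rep_map T a) n) _ _) _.
by rewrite /= (hx a) (hy a).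
Qed.
HB.instance Definition _ n :=
  GRing.isZmodClosed.Build (prodS n) (compatible n) (@compatible_closed n).

Fact compatible_bd n (x : prodS n.+1) :
  x \in compatible n.+1 -> bd prodS n x \in compatible n.
Proof.
move=> /compatibleP hx; apply/compatibleP => a.
by rewrite [LHS]sing_map_bd hx.
Qed.

(* The subcomplex of compatible families in the product of the complexes
   S(T(i)) over all vertices i. *)
Definition lim_complex : chain_complex := subcomplex compatible_bd.

Definition rep_homology n : zmodType := homology lim_complex n.

End LimitHomology.

Arguments rep_homology R {G} T n.

Section SubQuiver.
Variable G : quiver.

(* A sub-quiver contains the end points of each of its arrows. *)
Record subquiver := SubQuiver {
  sub_vertex : set (vertex G);
  sub_arrow : set (arrow G);
  sub_source : forall a, sub_arrow a -> sub_vertex (source a);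
  sub_target : forall a, sub_arrow a -> sub_vertex (target a)
}.

Definition quiver_of_sub (H : subquiver) : quiver :=
  @Quiver (sub_vertex H) (sub_arrow H)
    (fun a => exist _ (source (val a)) (mem_set (sub_source (set_valP a))))
    (fun a => exist _ (target (val a)) (mem_set (sub_target (set_valP a)))).

Definition subquiverT : subquiver :=
  @SubQuiver setT setT (fun _ _ => I) (fun _ _ => I).

Definition subquiver0 : subquiver :=
  @SubQuiver set0 set0 (fun _ => id) (fun _ => id).

Program Definition subquiverU (H K : subquiver) : subquiver :=
  @SubQuiver (sub_vertex H `|` sub_vertex K) (sub_arrow H `|` sub_arrow K) _ _.
Next Obligation. by move=> H K a [/sub_source|/sub_source]; [left|right]. Qed.
Next Obligation. by move=> H K a [/sub_target|/sub_target]; [left|right]. Qed.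

Program Definition subquiverI (H K : subquiver) : subquiver :=
  @SubQuiver (sub_vertex H `&` sub_vertex K) (sub_arrow H `&` sub_arrow K) _ _.
Next Obligation. by move=> H K a [/sub_source ? /sub_source ?]. Qed.
Next Obligation. by move=> H K a [/sub_target ? /sub_target ?]. Qed.

Definition restriction (T : top_rep G) (H : subquiver) : top_rep (quiver_of_sub H) :=
  @TopRep (quiver_of_sub H) (fun i => rep_space T (val i)) (fun a => rep_map T (val a)).

End SubQuiver.

(* Main.v *)
Require Import Defs.
From HB Require Import structures.
From mathcomp Require Import all_boot all_order all_algebra.
From mathcomp Require Import boolp classical_sets functions reals topology normedtype.
Set Implicit Arguments.
Unset Strict Implicit.
Unset Printing Implicit Defensive.
Import GRing.Theory.
Local Open Scope ring_scope.
Local Open Scope quotient_scope.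

(** Since the two sub-quivers are disjoint and cover the quiver, no arrow joins
    a vertex of the first to a vertex of the second. A family of chains indexed
    by all the vertices is therefore the same thing as a pair of families, one
    for each sub-quiver, and it is compatible with all the arrows exactly when
    both members of the pair are compatible with the arrows of their own
    sub-quiver. In other words the two restrictions [restrict_chain_map]
    exhibit the limit complex of the quiver as the product of the limit
    complexes of the sub-quivers: a family is determined by its two
    restrictions ([restrict_eq0]), and any two families can be glued
    ([restrict_glue]).

    Homology commutes with binary products of complexes, because cycles and
    boundaries of a product are computed componentwise. This is
    [homology_pair_bij], stated for any complex with two chain maps that make
    it a product in each degree. *)

(** * Homology of a product of two complexes *)

Record chain_map (C D : chain_complex) := ChainMap {
  cmap :> forall n, {additive C n -> D n};
  cmap_bd : forall n (x : C n.+1), cmap n (bd C n x) = bd D n (cmap n.+1 x)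
}.

Definition hclass (C : chain_complex) n (z : cycles C n) : homology C n :=
  \pi_(homology C n) z.

Lemma hclass_surj (C : chain_complex) n (c : homology C n) :
  exists z, hclass z = c.
Proof. by exists (repr c); apply: reprK. Qed.

Lemma hclassD (C : chain_complex) n (z w : cycles C n) :
  hclass (z + w) = hclass z + hclass w.
Proof. by rewrite /hclass !piE. Qed.

Lemma hclass_eqP (C : chain_complex) n (z w : cycles C n) :
  hclass z = hclass w <->
  exists y, bd C n y = subgroup_val z - subgroup_val w.
Proof.
rewrite (rwP eqP) -Quotient.idealrBE; exact: iff_sym (rwP (is_boundaryP _)).
Qed.

Section HomologyMap.
Variables (C D : chain_complex) (f : chain_map C D).

Fact cycles_map_subproof n (z : cycles C n) :
  f n (subgroup_val z) \in is_cycle (C := D) (n := n).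
Proof.
case: n z => [//|n] z; have /eqP hz := valP z.
by rewrite inE -cmap_bd hz raddf0.
Qed.

Definition cycles_map n (z : cycles C n) : cycles D n :=
  Subgroup (cycles_map_subproof z).

Definition homology_map n (c : homology C n) : homology D n :=
  hclass (cycles_map (repr c)).

Lemma homology_mapE n (z : cycles C n) :
  homology_map (hclass z) = hclass (cycles_map z).
Proof.
have /hclass_eqP[y hy] : hclass (repr (hclass z)) = hclass z by apply: reprK.
by apply/hclass_eqP; exists (f n.+1 y); rewrite -cmap_bd hy raddfB.
Qed.

Fact homology_map_additive n : nmod_morphism (@homology_map n).
Proof.
have homology_mapD : {morph @homology_map n : c d / c + d}.
  move=> c d; have [z <-] := hclass_surj c; have [w <-] := hclass_surj d.
  rewrite -hclassD !homology_mapE -hclassD; congr hclass.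
  by apply: val_inj; apply: (raddfD (f n)).
split=> //.
by apply: (addrI (homology_map 0)); rewrite -homology_mapD !addr0.
Qed.
HB.instance Definition _ n :=
  GRing.isNmodMorphism.Build _ _ (@homology_map n) (@homology_map_additive n).

End HomologyMap.

Section HomologyPair.
Variables (C D1 D2 : chain_complex) (f1 : chain_map C D1) (f2 : chain_map C D2).

Definition homology_pair n (c : homology C n) : homology D1 n * homology D2 n :=
  (homology_map f1 c, homology_map f2 c).

Fact homology_pair_additive n : nmod_morphism (@homology_pair n).
Proof.
by split=> [|c d]; rewrite /homology_pair ?raddf0 ?raddfD.
Qed.
HB.instance Definition _ n :=
  GRing.isNmodMorphism.Build _ _ (@homology_pair n) (@homology_pair_additive n).

Hypothesis f_inj : forall n (x : C n), f1 n x = 0 -> f2 n x = 0 -> x = 0.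
Hypothesis f_surj : forall n (y1 : D1 n) (y2 : D2 n),
  exists x : C n, f1 n x = y1 /\ f2 n x = y2.

(** A chain whose two components are cycles is a cycle, since its boundary has
    zero components; and a chain whose two components bound is the boundary of
    any chain having the two bounding chains as components. *)
Lemma homology_pair_bij n : bijective (@homology_pair n).
Proof.
rewrite -setTT_bijective; split=> [//|c d _ _|[c1 c2] _].
- have [z <-] := hclass_surj c; have [w <-] := hclass_surj d.
  rewrite /homology_pair !homology_mapE => -[/hclass_eqP[y1 h1] /hclass_eqP[y2 h2]].
  have [y [yy1 yy2]] := f_surj y1 y2.
  apply/hclass_eqP; exists y; apply/eqP; rewrite -subr_eq0; apply/eqP.
  by apply: f_inj; rewrite raddfB cmap_bd ?yy1 ?yy2 ?h1 ?h2 raddfB subrr.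
- have [z1 <-] := hclass_surj c1; have [z2 <-] := hclass_surj c2.
  have [x [x1 x2]] := f_surj (subgroup_val z1) (subgroup_val z2).
  have x_cycle : x \in is_cycle (C := C) (n := n).
    case: n x z1 z2 x1 x2 {c1 c2} => [//|n] x z1 z2 x1 x2.
    have /eqP h1 := valP z1; have /eqP h2 := valP z2.
    by rewrite inE; apply/eqP; apply: f_inj; rewrite cmap_bd ?x1 ?x2.
  exists (hclass (Subgroup x_cycle : cycles C n)) => //.
  by rewrite /homology_pair !homology_mapE; congr (hclass _, hclass _); apply: val_inj.
Qed.

End HomologyPair.

(** * The limit complex of a disjoint union of sub-quivers *)

Section Restriction.
Variables (R : realType) (G : quiver) (T : top_rep G) (H : subquiver G).

Fact restrict_subproof n (x : lim_complex R T n) :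
  (fun i => subgroup_val x (val i)) \in @compatible R _ (restriction T H) n.
Proof. by apply/compatibleP => a; have /compatibleP := valP x; apply. Qed.

Definition restrict n (x : lim_complex R T n) :
    lim_complex R (restriction T H) n :=
  Subgroup (restrict_subproof x).

Fact restrict_additive n : zmod_morphism (@restrict n).
Proof. by move=> x y; apply: val_inj. Qed.
HB.instance Definition _ n :=
  GRing.isZmodMorphism.Build _ _ (@restrict n) (@restrict_additive n).

Fact restrict_bd n (x : lim_complex R T n.+1) :
  restrict (bd _ n x) = bd _ n (restrict x).
Proof. exact: val_inj. Qed.

Definition restrict_chain_map :
    chain_map (lim_complex R T) (lim_complex R (restriction T H)) :=
  @ChainMap _ _ (fun n => @restrict n) restrict_bd.

Lemma restrict_eq0_at n (x : lim_complex R T n) i :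
  restrict x = 0 -> sub_vertex H i -> subgroup_val x i = 0.
Proof.
by move=> x0 Hi; rewrite -[LHS]/(subgroup_val (restrict x) (exist _ i (mem_set Hi))) x0.
Qed.

End Restriction.

Section DisjointUnion.
Variables (R : realType) (G : quiver) (G1 G2 : subquiver G).
Hypothesis G_union : subquiverU G1 G2 = subquiverT G.
Hypothesis G_inter : subquiverI G1 G2 = subquiver0 G.
Variable T : top_rep G.

Lemma vertex_cover i : sub_vertex G1 i \/ sub_vertex G2 i.
Proof.
have /(congr1 (fun A => A i)) /= -> // := congr1 (@sub_vertex G) G_union.
Qed.

Lemma arrow_cover a : sub_arrow G1 a \/ sub_arrow G2 a.
Proof.
have /(congr1 (fun A => A a)) /= -> // := congr1 (@sub_arrow G) G_union.
Qed.

Lemma vertex_disjoint i : sub_vertex G1 i -> sub_vertex G2 i -> False.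
Proof.
move=> i1 i2; have /(congr1 (fun A => A i)) /= <- := congr1 (@sub_vertex G) G_inter.
by split.
Qed.

Lemma restrict_eq0 n (x : lim_complex R T n) :
  restrict G1 x = 0 -> restrict G2 x = 0 -> x = 0.
Proof.
move=> x1 x2; apply: val_inj; apply: functional_extensionality_dep => i.
by case: (vertex_cover i) => hi; apply: restrict_eq0_at hi.
Qed.

Section Glue.
Variables (n : nat).
Variables (x1 : lim_complex R (restriction T G1) n).
Variables (x2 : lim_complex R (restriction T G2) n).

(** The value [0] is never taken, because the sub-quivers cover the vertices;
    disjointness makes the order of the two tests irrelevant. *)
Definition glue i : singular_complex R (rep_space T i) n :=
  match pselect (sub_vertex G1 i), pselect (sub_vertex G2 i) with
  | left i1, _ => subgroup_val x1 (exist _ i (mem_set i1))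
  | _, left i2 => subgroup_val x2 (exist _ i (mem_set i2))
  | _, _ => 0
  end.

Lemma glue1 (i : vertex (quiver_of_sub G1)) : glue (val i) = subgroup_val x1 i.
Proof.
case: i => i hi; rewrite /glue /=; case: pselect => [i1|]; last first.
  by case; apply: set_mem.
by rewrite (bool_irrelevance (mem_set i1) hi).
Qed.

Lemma glue2 (i : vertex (quiver_of_sub G2)) : glue (val i) = subgroup_val x2 i.
Proof.
case: i => i hi; rewrite /glue /=; case: pselect => [i1|_].
  by case: (vertex_disjoint i1); apply: set_mem.
case: pselect => [i2|]; last by case; apply: set_mem.
by rewrite (bool_irrelevance (mem_set i2) hi).
Qed.

(** Each arrow lies in one of the sub-quivers together with both of its end
    points, so its compatibility condition only involves one of the two
    families. *)
Lemma glue_compatible : glue \in @compatible R _ T n.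
Proof.
apply/compatibleP => a; case: (arrow_cover a) => ha.
- pose b : arrow (quiver_of_sub G1) := exist _ a (mem_set ha).
  rewrite (glue1 (source b)) (glue1 (target b)).
  exact: (compatibleP _ (valP x1) b).
- pose b : arrow (quiver_of_sub G2) := exist _ a (mem_set ha).
  rewrite (glue2 (source b)) (glue2 (target b)).
  exact: (compatibleP _ (valP x2) b).
Qed.

Lemma restrict_glue :
  exists x : lim_complex R T n, restrict G1 x = x1 /\ restrict G2 x = x2.
Proof.
exists (Subgroup glue_compatible); split; apply: val_inj;
  apply: functional_extensionality_dep; [exact: glue1 | exact: glue2].
Qed.

End Glue.

End DisjointUnion.

Theorem theorem4p20 (R : realType) (G : quiver) (G1 G2 : subquiver G)
    (G_union : subquiverU G1 G2 = subquiverT G)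
    (G_inter : subquiverI G1 G2 = subquiver0 G)
    (T : top_rep G) (n : nat) :
  exists phi : {additive rep_homology R T n ->
      (rep_homology R (restriction T G1) n *
       rep_homology R (restriction T G2) n)%type},
    bijective phi.
Proof.
exists (@homology_pair _ _ _ (restrict_chain_map R T G1)
          (restrict_chain_map R T G2) n).
apply: homology_pair_bij => m.
- exact: restrict_eq0.
- exact: restrict_glue.
Qed.
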